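(* Let $\varphi\in L^2(\mathbb{R}^2)$ satisfy assumption (A.1) stated in the context, and suppose that $\{\varphi(\cdot-\mathbf{k}):\mathbf{k}\in\mathbb{Z}^2\}$ is linearly independent. Let $\mathbf{p}=(\cos\theta,\sin\theta)$ be a direction vector such that $\mathcal{R}_{\mathbf{p}}\varphi$ is continuous. Let $E=\left[\lceil -N-K\rceil,\lfloor K+N\rfloor\right]^2\cap\mathbb{Z}^2=\{\mathbf{k}_1,\ldots,\mathbf{k}_{\mathcal{Q}}\}$, where $\mathcal{Q}$ is the cardinality of $E$. Let $X=\{\mathbf{x}_j\}_{j=1}^n\subseteq\mathcal{E}_K$ be a sampling set and let $U_{\varphi,\mathbf{p},X}$ be the $n\times\mathcal{Q}$ matrix whose $(j,l)$ entry is $\mathcal{R}_{\mathbf{p}}(\varphi(\mathbf{x}_j-\mathbf{k}_l))$. Then every $f\in\mathcal{S}_{N,K}(\varphi)$ can be determined completely by its Radon samples (with respect to $\mathbf{p}$) $\{\mathcal{R}_{\mathbf{p}}(f(\mathbf{x}_j))\}_{j=1}^n$ if and only if the $\mathcal{Q}\times\mathcal{Q}$ matrix $U_{\varphi,\mathbf{p},X}^{\mathrm{T}}U_{\varphi,\mathbf{p},X}$ is invertible.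
   Context: $N,K>0$ are fixed, $\mathcal{E}_K=[-K,K]^2$, and it is assumed throughout that $\mathcal{Q}>1$. The signal space is $$\mathcal{S}_{N,K}(\varphi)=\Big\{f:\ f(\mathbf{x})=\sum_{l=1}^{\mathcal{Q}}c_{\mathbf{k}_l}\varphi(\mathbf{x}-\mathbf{k}_l),\ c_{\mathbf{k}_l}\in\mathbb{R},\ \mathbf{x}\in\mathcal{E}_K\Big\}.$$ Assumption (A.1): $\varphi:\mathbb{R}^2\to\mathbb{R}$ is continuous with compact support contained in $[-N,N]^2$ and has stable shifts, i.e. there are constants $0<m_2\le M_2<\infty$ such that for every $C=(c_{\mathbf{k}_l})_{l=1}^{\mathcal{Q}}$, $$m_2\|C\|_{\ell^2}\le\Big\|\sum_{l=1}^{\mathcal{Q}}c_{\mathbf{k}_l}\varphi(\cdot-\mathbf{k}_l)\Big\|_{L^2(\mathcal{E}_K)}\le M_2\|C\|_{\ell^2}.$$ Radon transform: for $g:\mathbb{R}^2\to\mathbb{R}$ and $\mathbf{p}=(\cos\theta,\sin\theta)$, $\theta\in[0,2\pi)$, $$\mathcal{R}_{\mathbf{p}}g(t)=\int_{-\infty}^{\infty}g(t\cos\theta-s\sin\theta,\,t\sin\theta+s\cos\theta)\,ds,\quad t\in\mathbb{R}.$$ The notation $\mathcal{R}_{\mathbf{p}}(g(\mathbf{x}_j))$ means $\mathcal{R}_{\mathbf{p}}g(\mathbf{p}\cdot\mathbf{x}_j)$; in particular $\mathcal{R}_{\mathbf{p}}(\varphi(\mathbf{x}_j-\mathbf{k}_l))$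 is the Radon transform of $\varphi(\cdot-\mathbf{k}_l)$ evaluated at $\mathbf{p}\cdot\mathbf{x}_j$, that is, $\mathcal{R}_{\mathbf{p}}\varphi(\mathbf{p}\cdot(\mathbf{x}_j-\mathbf{k}_l))$. For $f=\sum_l c_{\mathbf{k}_l}\varphi(\cdot-\mathbf{k}_l)\in\mathcal{S}_{N,K}(\varphi)$, the Radon transform is taken of this finite sum, so $\mathcal{R}_{\mathbf{p}}(f(\mathbf{x}))=\sum_{l=1}^{\mathcal{Q}}c_{\mathbf{k}_l}\mathcal{R}_{\mathbf{p}}(\varphi(\mathbf{x}-\mathbf{k}_l))$ for $\mathbf{x}\in\mathcal{E}_K$. ''Determined completely'' means that if $f,g\in\mathcal{S}_{N,K}(\varphi)$ satisfy $\mathcal{R}_{\mathbf{p}}(f(\mathbf{x}_j))=\mathcal{R}_{\mathbf{p}}(g(\mathbf{x}_j))$ for all $j=1,\ldots,n$, then $f=g$ on $\mathcal{E}_K$. *)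

(* Defs.v *)
From HB Require Import structures.
From mathcomp Require Export all_boot all_order all_algebra.
From mathcomp Require Export all_classical all_reals all_analysis.

Set Implicit Arguments.
Unset Strict Implicit.
Unset Printing Implicit Defensive.

Export Order.TTheory GRing.Theory Num.Theory.
Export numFieldNormedType.Exports.

Local Open Scope classical_set_scope.
Local Open Scope ring_scope.

Definition lebesgue2 {R : realType} :=
  (@lebesgue_measure R \x @lebesgue_measure R)%E.

Definition square {R : realType} (r : R) : set (R * R) :=
  `[- r, r] `*` `[- r, r].

Definition lattice_pt {R : realType} (k : int * int) : R * R :=
  (k.1%:~R, k.2%:~R).

Definition shift {R : realType} (phi : R * R -> R) (k : int * int) :
    R * R -> R :=
  fun x => phi (x - lattice_pt k).

Definition index_set {R : realType} (N K : R) : set (int * int) :=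
  [set k | (Num.ceil (- N - K) <= k.1 <= Num.floor (K + N)) /\
           (Num.ceil (- N - K) <= k.2 <= Num.floor (K + N))].

Definition direction {R : realType} (theta : R) : R * R :=
  (cos theta, sin theta).

Definition dot {R : realType} (x y : R * R) : R := x.1 * y.1 + x.2 * y.2.

Definition radon {R : realType} (theta : R) (g : R * R -> R) (t : R) : R :=
  \int[lebesgue_measure]_s
    g (t * cos theta - s * sin theta, t * sin theta + s * cos theta).

Definition radon_at {R : realType} (theta : R) (g : R * R -> R) (x : R * R) :
    R :=
  radon theta g (dot (direction theta) x).

Definition supp {R : realType} (phi : R * R -> R) : set (R * R) :=
  closure [set x | phi x != 0].

Definition shift_comb {R : realType} (phi : R * R -> R) (Q : nat)
    (k : 'I_Q -> int * int) (c : 'cV[R]_Q) : R * R -> R :=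
  fun x => \sum_(l < Q) c l 0 * shift phi (k l) x.

Definition l2norm {R : realType} (Q : nat) (c : 'cV[R]_Q) : R :=
  Num.sqrt (\sum_(l < Q) c l 0 ^+ 2).

Definition L2norm_on {R : realType} (D : set (R * R)) (f : R * R -> R) :
    \bar R :=
  ('N[lebesgue2]_2%:E [EFin \o (f \_ D)])%E.

Definition stable_shifts {R : realType} (K : R) (phi : R * R -> R) (Q : nat)
    (k : 'I_Q -> int * int) : Prop :=
  exists m2 M2 : R, [/\ 0 < m2, m2 <= M2 & forall c : 'cV[R]_Q,
    ((m2 * l2norm c)%:E <= L2norm_on (square K) (shift_comb phi k c))%E /\
    (L2norm_on (square K) (shift_comb phi k c) <= (M2 * l2norm c)%:E)%E].

Definition assumption_A1 {R : realType} (N K : R) (phi : R * R -> R) (Q : nat)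
    (k : 'I_Q -> int * int) : Prop :=
  [/\ continuous phi, compact (supp phi), supp phi `<=` square N
    & stable_shifts K phi k].

Definition lin_indep_shifts {R : realType} (phi : R * R -> R) : Prop :=
  forall (s : seq (int * int)) (c : int * int -> R), uniq s ->
    (forall x, \sum_(k <- s) c k * shift phi k x = 0) ->
    forall k, k \in s -> c k = 0.

(* Elements of the signal space are functions on [-K, K]^2: only the values
   on the square matter, the values of [f] outside it are junk. *)
Definition represents {R : realType} (K : R) (phi : R * R -> R) (Q : nat)
    (k : 'I_Q -> int * int) (f : R * R -> R) (c : 'cV[R]_Q) : Prop :=
  forall x, square K x -> f x = shift_comb phi k c x.

Definition signal_space {R : realType} (K : R) (phi : R * R -> R) (Q : nat)
    (k : 'I_Q -> int * int) : set (R * R -> R) :=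
  [set f | exists c, represents K phi k f c].

(* The finite sum on the whole plane attached to a signal on the square; by
   [represents_inj] its coefficients are unique when the shifts are stable, so
   that the choice made by [xget] is immaterial. *)
Definition signal_sum {R : realType} (K : R) (phi : R * R -> R) (Q : nat)
    (k : 'I_Q -> int * int) (f : R * R -> R) : R * R -> R :=
  shift_comb phi k (xget 0 [set c | represents K phi k f c]).

Definition determined_by_radon {R : realType} (K : R) (phi : R * R -> R)
    (Q : nat) (k : 'I_Q -> int * int) (theta : R) (n : nat)
    (x : 'I_n -> R * R) : Prop :=
  forall f g, signal_space K phi k f -> signal_space K phi k g ->
    (forall j, radon_at theta (signal_sum K phi k f) (x j) =
               radon_at theta (signal_sum K phi k g) (x j)) ->
    forall y, square K y -> f y = g y.

Definition radon_matrix {R : realType} (phi : R * R -> R) (Q : nat)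
    (k : 'I_Q -> int * int) (theta : R) (n : nat) (x : 'I_n -> R * R) :
    'M[R]_(n, Q) :=
  \matrix_(j < n, l < Q) radon_at theta (shift phi (k l)) (x j).

Lemma represents_inj {R : realType} (K : R) (phi : R * R -> R) (Q : nat)
    (k : 'I_Q -> int * int) (f : R * R -> R) (c d : 'cV[R]_Q) :
  stable_shifts K phi k ->
  represents K phi k f c -> represents K phi k f d -> c = d.
Proof.
move=> [m [M [m0 _ H]]] fc fd.
have [+ _] := H (c - d).
have -> : L2norm_on (square K) (shift_comb phi k (c - d)) = 0%E.
  rewrite /L2norm_on (_ : _ \o _ = cst 0%E) ?Lnorm0 ?eqe ?pnatr_eq0//.
  apply/funext => x /=; congr EFin; rewrite patchE; case: ifPn => // /set_mem Kx.
  have := fd x Kx; rewrite (fc x Kx) => /eqP; rewrite -subr_eq0 => /eqP cd0.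
  rewrite -[RHS]cd0 /shift_comb -sumrB.
  by apply: eq_bigr => l _; rewrite !mxE mulrBl.
rewrite lee_fin pmulr_rle0// => le0.
have ge0 (l : 'I_Q) : true -> 0 <= (c - d) l 0 ^+ 2 by rewrite sqr_ge0.
have: \sum_(l < Q) (c - d) l 0 ^+ 2 == 0.
  by rewrite eq_le sumr_ge0// andbT -sqrtr_eq0 eq_le le0 sqrtr_ge0.
rewrite psumr_eq0// => /allP z.
apply/colP => l; have := z l (mem_index_enum _).
by rewrite implyTb sqrf_eq0 !mxE subr_eq0 => /eqP.
Qed.

(* Main.v *)
(* The restriction of a shift of phi to a line is continuous with compact
   support, hence integrable, so the Radon samples of the sum with coefficient
   vector c form the vector U c.  By stability of the shifts, signals on the
   square correspond bijectively to coefficient vectors, so being determined by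
   the samples means that U is injective.  Finally ker (U^T U) = ker U, since
   c^T U^T U c is the sum of the squares of the entries of U c. *)
Require Import Defs.
From mathcomp Require Import ring.

Local Open Scope classical_set_scope.
Local Open Scope ring_scope.

Lemma mulTmx_col_eq0 (F : realFieldType) (m : nat) (v : 'cV[F]_m) :
  v^T *m v = 0 -> v = 0.
Proof.
move=> /matrixP/(_ 0 0); rewrite !mxE => sum0.
apply/colP => i; rewrite mxE; apply/eqP; rewrite -sqrf_eq0; apply/eqP.
apply: (psumr_eq0P (P := predT) (F := fun j => v j 0 ^+ 2)) => //.
- by move=> j _; rewrite sqr_ge0.
- by rewrite -[RHS]sum0; apply: eq_bigr => j _; rewrite mxE expr2.
Qed.

Lemma gram_unitmxP (F : realFieldType) (m p : nat) (U : 'M[F]_(m, p)) :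
  U^T *m U \in unitmx <-> forall c : 'cV[F]_p, U *m c = 0 -> c = 0.
Proof.
split=> [Uu c Uc0|inj].
  by rewrite -[c](mulKmx Uu) -mulmxA Uc0 !mulmx0.
(* For a square matrix a trivial left kernel suffices. If the row [v] kills [U^T *m U], the column w
   = U v^T satisfies w^T w = v U^T U v^T = 0, hence w = 0. *)
rewrite -row_free_unit; apply: inj_row_free => v vUU.
apply: trmx_inj; rewrite trmx0; apply: inj; apply: mulTmx_col_eq0.
by rewrite trmx_mul trmxK mulmxA -(mulmxA v) vUU mul0mx.
Qed.

(** Outside [-M, M] the function [h] vanishes, so it equals its restriction to that compact
    interval, where continuity gives integrability. *)
Lemma continuous_integrable_bounded_support (R : realType) (h : R -> R) (M : R) :
  continuous h -> (forall s, h s != 0 -> `|s| <= M) ->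
  (@lebesgue_measure R).-integrable setT (EFin \o h).
Proof.
move=> hc hM.
have hI : (@lebesgue_measure R).-integrable `[- M, M] (EFin \o h).
  apply: continuous_compact_integrable; first exact: segment_compact.
  exact: continuous_subspaceT.
move: hI; rewrite integrable_mkcond//.
apply: eq_integrable => // s _.
rewrite patchE; case: ifPn => //= /negP sM.
apply/esym/eqP; rewrite eqe; apply/negPn/negP => /hM.
by rewrite ler_norml => sM'; apply: sM; rewrite inE/= in_itv.
Qed.

Section RadonOfSums.
Variables (R : realType) (N : R) (phi : R * R -> R).
Hypotheses (phi_cont : continuous phi) (phi_supp : supp phi `<=` square N).

Lemma neq0_square (y : R * R) : phi y != 0 -> `|y.1| <= N /\ `|y.2| <= N.
Proof.
move=> y0; have [] : square N y by apply: phi_supp; exact: subset_closure.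
by rewrite /= !in_itv/= !ler_norml.
Qed.

Lemma shift_line_integrable (theta t : R) (k : int * int) :
  (@lebesgue_measure R).-integrable setT (EFin \o fun s =>
    shift phi k (t * cos theta - s * sin theta, t * sin theta + s * cos theta)).
Proof.
set a := t * cos theta - k.1%:~R; set b := t * sin theta - k.2%:~R.
(* At parameter s the shifted line is at (a - s sin theta, b + s cos theta). Where [phi] is nonzero
   both coordinates are at most N in absolute value, so their offsets from [a] and [b] are at most N
   + |a| and N + |b|; the bound on |s| is the sum of these. *)
apply: (@continuous_integrable_bounded_support _ _ (N + `|a| + (N + `|b|))).
  pose line (s : R) : R * R := (t * cos theta - s * sin theta - k.1%:~R,
                                t * sin theta + s * cos theta - k.2%:~R).
  have line_cont : continuous line.
    move=> s; apply: (@cvg_pair _ _ _ _ (nbhs (line s).1) (nbhs (line s).2)) => /=.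
      apply: cvgB; last exact: cvg_cst.
      by apply: cvgB; [exact: cvg_cst|apply: cvgMr_tmp; exact: cvg_id].
    apply: cvgB; last exact: cvg_cst.
    by apply: cvgD; [exact: cvg_cst|apply: cvgMr_tmp; exact: cvg_id].
  move=> s; exact: (continuous_comp (line_cont s) (@phi_cont _)).
move=> s /neq0_square[/=].
set u := _ - k.1%:~R; set v := _ - k.2%:~R => uN vN.
(* Since u - a = -s sin theta and v - b = s cos theta, the identity cos^2 + sin^2 = 1 recovers s
   from the two offsets. *)
have sE : s = (v - b) * cos theta - (u - a) * sin theta.
  have cs := cos2Dsin2 theta.
  by rewrite /u /v /a /b -[LHS]mulr1 -cs; ring.
rewrite sE (le_trans (ler_normB _ _))// addrC !normrM lerD//.
- rewrite -[leRHS]mulr1 ler_pM// ?(le_trans (ler_normB _ _)) ?lerD//.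
  by rewrite ler_norml sin_geN1 sin_le1.
- rewrite -[leRHS]mulr1 ler_pM// ?(le_trans (ler_normB _ _)) ?lerD//.
  by rewrite ler_norml cos_geN1 cos_le1.
Qed.

Lemma radon_at_shift_comb (Q : nat) (k : 'I_Q -> int * int) (theta : R)
    (c : 'cV[R]_Q) (n : nat) (x : 'I_n -> R * R) (j : 'I_n) :
  radon_at theta (shift_comb phi k c) (x j) =
  (radon_matrix phi k theta x *m c) j 0.
Proof.
rewrite mxE /radon_at /radon; set t := dot _ _.
pose g l s := shift phi (k l)
  (t * cos theta - s * sin theta, t * sin theta + s * cos theta).
have gI l : (@lebesgue_measure R).-integrable setT (EFin \o g l).
  exact: shift_line_integrable.
have cgI l : (@lebesgue_measure R).-integrable setT (fun s => (c l 0 * g l s)%:E).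
  by apply: eq_integrable (integrableZl _ (c l 0) (gI l)).
transitivity (\sum_(l < Q)
    \int[@lebesgue_measure R]_s (c l 0 * g l s)).
  (* The real integral is [fine] of the extended one, and [fine] commutes with the sum because every
     term is finite. *)
  rewrite sum_fine; last by move=> l _; exact: integrable_fin_num.
  congr fine; rewrite -integral_sum//.
  by apply: eq_integral => s _; rewrite sumEFin.
apply: eq_bigr => l _.
by rewrite RintegralZl// mulrC mxE.
Qed.

End RadonOfSums.

(** Uniqueness of the coefficients forces the vector picked by [xget] to be [c]. *)
Lemma signal_sum_shift_comb (R : realType) (K : R) (phi : R * R -> R) (Q : nat)
    (k : 'I_Q -> int * int) (f : R * R -> R) (c : 'cV[R]_Q) :
  stable_shifts K phi k -> represents K phi k f c ->
  signal_sum K phi k f = shift_comb phi k c.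
Proof.
move=> st fc; congr shift_comb; apply: xget_unique => // d fd.
exact: represents_inj st fd fc.
Qed.

Theorem theorem2p1 (R : realType) (N K : R) (hN : 0 < N) (hK : 0 < K)
    (Q : nat) (hQ : (1 < Q)%N) (k : 'I_Q -> int * int)
    (hk : set_bij [set: 'I_Q] (index_set N K) k)
    (phi : R * R -> R) (hphi2 : phi \in Lfun lebesgue2 2%:E)
    (hA1 : assumption_A1 N K phi k) (hind : lin_indep_shifts phi)
    (theta : R) (htheta : 0 <= theta < 2 * pi)
    (hradon : continuous (radon theta phi))
    (n : nat) (x : 'I_n -> R * R) (hx : forall j, square K (x j)) :
  determined_by_radon K phi k theta x <->
  (radon_matrix phi k theta x)^T *m radon_matrix phi k theta x \in unitmx.
Proof.
have [cphi _ sphi st] := hA1.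
have radonE := radon_at_shift_comb _ _ _ cphi sphi _ k theta.
set U := radon_matrix _ _ _ _.
have sumE c : signal_sum K phi k (shift_comb phi k c) = shift_comb phi k c.
  exact: signal_sum_shift_comb.
apply: (iff_trans _ (iff_sym (gram_unitmxP _ _ _ U))); split=> [det c Uc0|inj f g].
  (* The signal of [c] is compared with the zero signal. Both have zero samples, so they agree on
     the square, and uniqueness of coefficients gives c = 0. *)
  have inS d : signal_space K phi k (shift_comb phi k d) by exists d.
  have eqf := det _ _ (inS c) (inS 0).
  apply: (@represents_inj R K phi Q k (shift_comb phi k c)) => // y Ky.
  by apply: eqf => // j; rewrite !sumE !radonE Uc0 mulmx0.
move=> [c fc] [d gd] samples y Ky.
rewrite fc// gd//; congr (shift_comb _ _ _ _).
(* Equal samples mean U c = U d, so injectivity is applied to [c - d]. *)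
apply/eqP; rewrite -subr_eq0; apply/eqP/inj.
apply/colP => j; rewrite mulmxBr !mxE.
have := samples j; rewrite (signal_sum_shift_comb _ _ _ _ _ _ _ st fc).
rewrite (signal_sum_shift_comb _ _ _ _ _ _ _ st gd) !radonE !mxE => ->.
by rewrite subrr.
Qed.
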